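(* There is a parameter $c \in \mathrm{CompStr}$ such that $\mathcal{L}_c$ contains a ternary relation symbol $F$ and, letting $\Gamma := \{F(x, y; z)\}$, if $\mathcal{N} \cong \mathcal{M}_c$ then uniformly in $\mathcal{N}$ we can compute $\mathrm{Fin}$ from $\mathrm{dcl}_{\Gamma, \mathcal{N}}$ via a $1$-reduction relative to $\mathcal{N}$. In particular, for computable such $\mathcal{N}$, the set $\mathrm{dcl}_{\Gamma, \mathcal{N}}$ is $\Sigma^0_2$-complete.
   Context: Computable structures. Languages are relational and may be many-sorted: $\mathcal{L} = ((X_j)_{j\in J}, (R_i)_{i\in I})$ with sorts $X_j$ and relation symbols $R_i$, where $I,J\in\mathbb{N}\cup\{\mathbb{N}\}$ (a natural number is identified with the set of its predecessors). The type of a tuple of elements or variables is the product of the sorts of its entries, in order; the type of a relation symbol is a finite product of sorts. $\mathcal{L}$ is computable when the function sending $i\in I$ to $(j_0,\dots,j_{m-1})$, where $R_i$ has type $\prod_{k<m}X_{j_k}$, is computable; for each computable language a computable encoding of its first-order formulas is fixed. A computable $\mathcal{L}$-structure $\mathcal{N}$ has a computable underlying set, and $\{(a,j) : a\in (X_j)^{\mathcal{N}}\}$ and $\{(\overline{b},i) : \overline{b}\in (R_i)^{\mathcal{N}}\}$ are computable. Writing $\{e\}$ for the $e$th Turing machine, $c\in\mathbb{N}$ is a code for a structure if $\{c\}(0)$ is a code for a computable language, denoted $\mathcal{L}_c$, and $\{c\}(1)$ is a code for a computable $\mathcal{L}_c$-structure, denoted $\mathcal{M}_c$. $\mathrm{CompStr}$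 is the set of all codes for structures. Formulas $\varphi(\overline{x};\overline{y})$ come with a specified partition of their free variables; $F(x,y;z)$ is the formula $F(x,y,z)$ partitioned as $xy;z$. For a set $\Phi$ of first-order $\mathcal{L}$-formulas, an $\mathcal{L}$-structure $\mathcal{N}$ and $B\subseteq\mathcal{N}$: let $\mathrm{cl}^0(B):=B$; let $\mathrm{cl}^1(B)$ be $B$ together with all $b\in\mathcal{N}$ for which there are $\varphi(\overline{x};\overline{y})\in\Phi$ and a tuple $\overline{a}$ from $B$ such that $|\{\overline{d} : \mathcal{N}\models\varphi(\overline{a};\overline{d})\}|=1$, and a tuple $\overline{b}\in\mathcal{N}$ having $b$ as an entry with $\mathcal{N}\models\varphi(\overline{a};\overline{b})$; let $\mathrm{cl}^{m+1}(B):=\mathrm{cl}^1(\mathrm{cl}^m(B))$; and let $\mathrm{dcl}_{\Phi,\mathcal{N}}(B):=\bigcup_m\mathrm{cl}^m(B)$. As a set, $\mathrm{dcl}_{\Phi,\mathcal{N}}:=\{(a,A) : A\subseteq\mathcal{N}\text{ finite},\ a\in\mathrm{dcl}_{\Phi,\mathcal{N}}(A)\}$. $\mathrm{Fin}:=\{e\in\mathbb{N} : W_e\text{ is finite}\}$, where $W_e=\{n : \{e\}(n)\text{ converges}\}$. Here $\mathcal{N}$ is a structure presented on a set of natural numbers; ''uniformly in $\mathcal{N}$'' means by a single procedure having (the atomic diagram of) $\mathcal{N}$ as an oracle, and a $1$-reduction relative to $\mathcal{N}$ is an injective many-one reduction computable from $\mathcal{N}$. *)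

(* Defs.v *)
From Stdlib Require Import Arith List Lia Cantor.
Import ListNotations.

(** * Coding *)

Definition npair (x y : nat) : nat := Cantor.to_nat (x, y).

Fixpoint code_tuple (s : list nat) : nat :=
  match s with
  | [] => 0
  | x :: t => S (npair x (code_tuple t))
  end.

(* The finite set with canonical index [u], i.e. [u = sum of 2^x for x in it].
   Every finite set of naturals has exactly one index, so that injectivity of
   a function into (codes of) pairs (element, finite set) is unambiguous. *)
Definition canonical_finset (u : nat) : nat -> Prop :=
  fun x => Nat.testbit u x = true.

(** * Oracle computation *)

(* Programs for the partial recursive functions of one argument relative to a
   set; several arguments are passed through the (bijective) Cantor pairing. *)
Inductive program : Type :=
| PZero | PSucc | PFst | PSnd | POracle
| PPair (p q : program)
| PComp (p q : program)
| PRec (p q : program)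
| PMu (p : program).

(* [runs O p x y]: with oracle [O], program [p] on input [x] halts with
   output [y]. *)
Inductive runs (O : nat -> Prop) : program -> nat -> nat -> Prop :=
| runs_zero x : runs O PZero x 0
| runs_succ x : runs O PSucc x (S x)
| runs_fst x y : runs O PFst (npair x y) x
| runs_snd x y : runs O PSnd (npair x y) y
| runs_oracle_yes x : O x -> runs O POracle x 1
| runs_oracle_no x : ~ O x -> runs O POracle x 0
| runs_pair p q x y z :
    runs O p x y -> runs O q x z -> runs O (PPair p q) x (npair y z)
| runs_comp p q x y z :
    runs O q x y -> runs O p y z -> runs O (PComp p q) x z
| runs_rec_0 p q x y :
    runs O p x y -> runs O (PRec p q) (npair x 0) y
| runs_rec_S p q x n y z :
    runs O (PRec p q) (npair x n) y ->
    runs O q (npair x (npair n y)) z ->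
    runs O (PRec p q) (npair x (S n)) z
| runs_mu p x n :
    runs O p (npair x n) 0 ->
    (forall k, k < n -> exists y, runs O p (npair x k) (S y)) ->
    runs O (PMu p) x n.

Fixpoint program_index (p : program) : nat :=
  match p with
  | PZero => 0
  | PSucc => 1
  | PFst => 2
  | PSnd => 3
  | POracle => 4
  | PPair p q => 5 + 4 * npair (program_index p) (program_index q)
  | PComp p q => 6 + 4 * npair (program_index p) (program_index q)
  | PRec p q => 7 + 4 * npair (program_index p) (program_index q)
  | PMu p => 8 + 4 * program_index p
  end.

(* The first argument is recursion fuel; see [program_of_index]. *)
Fixpoint program_of_fuel (k e : nat) : program :=
  match k with
  | 0 => PZero
  | S k =>
    match e with
    | 0 => PZero
    | 1 => PSucc
    | 2 => PFst
    | 3 => PSnd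
    | 4 => POracle
    | S (S (S (S (S m)))) =>
      let p := program_of_fuel k (fst (Cantor.of_nat (m / 4))) in
      let q := program_of_fuel k (snd (Cantor.of_nat (m / 4))) in
      match m mod 4 with
      | 0 => PPair p q
      | 1 => PComp p q
      | 2 => PRec p q
      | _ => PMu (program_of_fuel k (m / 4))
      end
    end
  end.

Definition program_of_index (e : nat) : program := program_of_fuel (S e) e.

(* [phi O e x y] reads {e}^O(x) = y. *)
Definition phi (O : nat -> Prop) (e x y : nat) : Prop :=
  runs O (program_of_index e) x y.

Definition no_oracle : nat -> Prop := fun _ => False.

Definition W (e n : nat) : Prop := exists y, phi no_oracle e n y.

Definition Fin (e : nat) : Prop := exists s : list nat, forall n, W e n -> In n s.

Definition decides (e : nat) (A : nat -> Prop) : Prop :=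
  forall x, (A x /\ phi no_oracle e x 1) \/ (~ A x /\ phi no_oracle e x 0).

Definition computable_set (A : nat -> Prop) : Prop := exists e, decides e A.

Definition one_reduction (O : nat -> Prop) (p : nat) (A B : nat -> Prop) : Prop :=
  exists f : nat -> nat,
    (forall x, phi O p x (f x)) /\
    (forall x y, f x = f y -> x = y) /\
    (forall x, A x <-> B (f x)).

Definition Sigma02 (A : nat -> Prop) : Prop :=
  exists R : nat -> Prop, computable_set R /\
    forall x, A x <-> exists n, forall m, R (npair x (npair n m)).

Definition Sigma02_complete (A : nat -> Prop) : Prop :=
  Sigma02 A /\
  forall B, Sigma02 B -> exists p, one_reduction no_oracle p B A.

(** * Many-sorted relational languages and structures *)

(* Elements of N ∪ {N}; [None] stands for N. *)
Definition in_index (k : option nat) (i : nat) : Prop :=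
  match k with
  | None => True
  | Some n => i < n
  end.

(* Values of [rel_type] outside of the index set are irrelevant. *)
Record language := Language {
  rel_index : option nat;
  sort_index : option nat;
  rel_type : nat -> list nat
}.

Definition is_language (L : language) : Prop :=
  forall i, in_index (rel_index L) i ->
    Forall (in_index (sort_index L)) (rel_type L i).

(* Structures presented on a set of natural numbers. *)
Record structure := Structure {
  dom : nat -> Prop;
  in_sort : nat -> nat -> Prop;
  in_rel : nat -> list nat -> Prop
}.

Definition is_structure (L : language) (N : structure) : Prop :=
  (forall j a, in_sort N j a -> in_index (sort_index L) j /\ dom N a) /\
  (forall a, dom N a -> exists! j, in_sort N j a) /\
  (forall i s, in_rel N i s ->
     in_index (rel_index L) i /\ Forall2 (in_sort N) (rel_type L i) s).

Definition isomorphic (L : language) (N M : structure) : Prop :=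
  exists h : nat -> nat,
    (forall a, dom N a -> dom M (h a)) /\
    (forall a b, dom N a -> dom N b -> h a = h b -> a = b) /\
    (forall b, dom M b -> exists a, dom N a /\ h a = b) /\
    (forall j a, in_index (sort_index L) j -> dom N a ->
       (in_sort N j a <-> in_sort M j (h a))) /\
    (forall i s, in_index (rel_index L) i -> Forall (dom N) s ->
       (in_rel N i s <-> in_rel M i (map h s))).

Definition sort_diagram (N : structure) : nat -> Prop :=
  fun w => exists a j, w = npair a j /\ in_sort N j a.

Definition rel_diagram (N : structure) : nat -> Prop :=
  fun w => exists s i, w = npair (code_tuple s) i /\ in_rel N i s.

(* The join of the three sets above; equality of elements is equality in nat. *)
Definition atomic_diagram (N : structure) : nat -> Prop :=
  fun w =>
    (exists a, w = npair 0 a /\ dom N a) \/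
    (exists v, w = npair 1 v /\ sort_diagram N v) \/
    (exists v, w = npair 2 v /\ rel_diagram N v).

(** * Codes for computable languages and structures *)

Definition code_index (k : option nat) : nat :=
  match k with
  | None => 0
  | Some n => S n
  end.

(* A code for L consists of I, J and an index of the function giving the
   types of the relation symbols. *)
Definition codes_language (l : nat) (L : language) : Prop :=
  is_language L /\
  exists t,
    l = npair (npair (code_index (rel_index L)) (code_index (sort_index L))) t /\
    forall i, in_index (rel_index L) i ->
      phi no_oracle t i (code_tuple (rel_type L i)).

Definition codes_structure (L : language) (s : nat) (N : structure) : Prop :=
  is_structure L N /\
  exists u v r,
    s = npair u (npair v r) /\
    decides u (dom N) /\
    decides v (sort_diagram N) /\
    decides r (rel_diagram N).

Definition computable_structure (L : language) (N : structure) : Prop :=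
  exists s, codes_structure L s N.

(* [CompStr_code c L M]: c is in CompStr, with L_c = L and M_c = M. *)
Definition CompStr_code (c : nat) (L : language) (M : structure) : Prop :=
  exists l s,
    phi no_oracle c 0 l /\ codes_language l L /\
    phi no_oracle c 1 s /\ codes_structure L s M.

(** * First-order formulas *)

(* The variable [(j, k)] is the [k]-th variable of sort [j]. *)
Definition var : Type := (nat * nat)%type.

Definition var_eq_dec (x y : var) : {x = y} + {x <> y}.
Proof. decide equality; apply Nat.eq_dec. Defined.

Inductive formula : Type :=
| FEq (x y : var)
| FRel (i : nat) (xs : list var)
| FNot (f : formula)
| FAnd (f g : formula)
| FOr (f g : formula)
| FImp (f g : formula)
| FAll (x : var) (f : formula)
| FEx (x : var) (f : formula).

Fixpoint is_formula (L : language) (f : formula) : Prop :=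
  match f with
  | FEq x y => in_index (sort_index L) (fst x) /\ fst x = fst y
  | FRel i xs => in_index (rel_index L) i /\ map fst xs = rel_type L i
  | FNot f => is_formula L f
  | FAnd f g | FOr f g | FImp f g => is_formula L f /\ is_formula L g
  | FAll x f | FEx x f => in_index (sort_index L) (fst x) /\ is_formula L f
  end.

Fixpoint free_in (v : var) (f : formula) : Prop :=
  match f with
  | FEq x y => v = x \/ v = y
  | FRel _ xs => In v xs
  | FNot f => free_in v f
  | FAnd f g | FOr f g | FImp f g => free_in v f \/ free_in v g
  | FAll x f | FEx x f => v <> x /\ free_in v f
  end.

Definition update (e : var -> nat) (x : var) (a : nat) : var -> nat :=
  fun y => if var_eq_dec x y then a else e y.

(* Only the values of [e] at the free variables of [f] matter; in particular
   [e] may take arbitrary values at variables of an empty sort. *)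
Fixpoint sat (N : structure) (e : var -> nat) (f : formula) : Prop :=
  match f with
  | FEq x y => e x = e y
  | FRel i xs => in_rel N i (map e xs)
  | FNot f => ~ sat N e f
  | FAnd f g => sat N e f /\ sat N e g
  | FOr f g => sat N e f \/ sat N e g
  | FImp f g => sat N e f -> sat N e g
  | FAll x f => forall a, in_sort N (fst x) a -> sat N (update e x a) f
  | FEx x f => exists a, in_sort N (fst x) a /\ sat N (update e x a) f
  end.

Fixpoint assign (xs : list var) (s : list nat) : var -> nat :=
  match xs, s with
  | x :: xs, a :: s => update (assign xs s) x a
  | _, _ => fun _ => 0
  end.

(* A formula f(x;y) with a partition of its free variables into [xpart] and
   [ypart]. *)
Record pformula := PFormula {
  body : formula;
  xpart : list var;
  ypart : list var
}.

Definition is_pformula (L : language) (f : pformula) : Prop :=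
  is_formula L (body f) /\
  NoDup (xpart f ++ ypart f) /\
  forall v, free_in v (body f) <-> In v (xpart f ++ ypart f).

Definition has_type (N : structure) (xs : list var) (s : list nat) : Prop :=
  Forall2 (fun x a => in_sort N (fst x) a) xs s.

(* [N |= f(a; d)] for tuples [a], [d] of the types of the two parts. *)
Definition psat (N : structure) (f : pformula) (a d : list nat) : Prop :=
  has_type N (xpart f) a /\ has_type N (ypart f) d /\
  sat N (assign (xpart f ++ ypart f) (a ++ d)) (body f).

(** * Definable closure *)

Definition cl1 (Phi : pformula -> Prop) (N : structure) (B : nat -> Prop)
    : nat -> Prop :=
  fun b => B b \/
    exists f a,
      Phi f /\ Forall B a /\
      (exists! d, psat N f a d) /\
      exists s, In b s /\ psat N f a s.

Fixpoint cl (Phi : pformula -> Prop) (N : structure) (m : nat) (B : nat -> Prop)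
    : nat -> Prop :=
  match m with
  | 0 => B
  | S m => cl1 Phi N (cl Phi N m B)
  end.

Definition dcl (Phi : pformula -> Prop) (N : structure) (B : nat -> Prop)
    : nat -> Prop :=
  fun b => exists m, cl Phi N m B b.

Definition dcl_set (Phi : pformula -> Prop) (N : structure) : nat -> Prop :=
  fun w => exists a u,
    w = npair a u /\
    (forall x, canonical_finset u x -> dom N x) /\
    dcl Phi N (canonical_finset u) a.

(* The formula F(x, y; z), for F of type X_j0 * X_j1 * X_j2. *)
Definition ternary_pformula (F j0 j1 j2 : nat) : pformula :=
  PFormula (FRel F [(j0, 0); (j1, 1); (j2, 2)]) [(j0, 0); (j1, 1)] [(j2, 2)].

Definition Gamma (F j0 j1 j2 : nat) : pformula -> Prop :=
  fun f => f = ternary_pformula F j0 j1 j2.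

Lemma ternary_pformula_ok (L : language) (F j0 j1 j2 : nat) :
  in_index (rel_index L) F -> rel_type L F = [j0; j1; j2] ->
  is_pformula L (ternary_pformula F j0 j1 j2).
Proof.
intros HF HT. split; [|split].
- split; [exact HF | now rewrite HT].
- cbn. repeat constructor; cbn; intuition congruence.
- intros v. cbn. tauto.
Qed.

(** * Every program has an index *)

Lemma npair_le (x y : nat) : x <= npair x y /\ y <= npair x y.
Proof.
unfold npair. pose proof (Cantor.to_nat_non_decreasing x y). lia.
Qed.

Lemma program_of_fuel_index (p : program) (k : nat) :
  program_index p < k -> program_of_fuel k (program_index p) = p.
Proof.
assert (D : forall q r, r < 4 -> (r + 4 * q) / 4 = q /\ (r + 4 * q) mod 4 = r).
{ intros q r Hr. rewrite (Nat.mul_comm 4 q). split.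
  - rewrite Nat.div_add, Nat.div_small; lia.
  - rewrite Nat.Div0.mod_add, Nat.mod_small; lia. }
revert k; induction p as [| | | | |p IHp q IHq|p IHp q IHq|p IHp q IHq|p IHp];
  intros [|k] Hk; try lia; try reflexivity.
1-3: cbn [program_index] in Hk |- *;
  pose proof (npair_le (program_index p) (program_index q)) as Hle;
  set (n := npair (program_index p) (program_index q)) in *.
- change (5 + 4 * n) with (S (S (S (S (S (0 + 4 * n)))))).
  cbn [program_of_fuel]. destruct (D n 0) as [-> ->]; [lia|].
  unfold n, npair. rewrite Cantor.cancel_of_to. cbn [fst snd].
  now rewrite IHp, IHq by lia.
- change (6 + 4 * n) with (S (S (S (S (S (1 + 4 * n)))))).
  cbn [program_of_fuel]. destruct (D n 1) as [-> ->]; [lia|].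
  unfold n, npair. rewrite Cantor.cancel_of_to. cbn [fst snd].
  now rewrite IHp, IHq by lia.
- change (7 + 4 * n) with (S (S (S (S (S (2 + 4 * n)))))).
  cbn [program_of_fuel]. destruct (D n 2) as [-> ->]; [lia|].
  unfold n, npair. rewrite Cantor.cancel_of_to. cbn [fst snd].
  now rewrite IHp, IHq by lia.
- cbn [program_index] in Hk |- *. set (n := program_index p) in *.
  change (8 + 4 * n) with (S (S (S (S (S (3 + 4 * n)))))).
  cbn [program_of_fuel]. destruct (D n 3) as [-> ->]; [lia|].
  unfold n. now rewrite IHp by (fold n; lia).
Qed.

Lemma program_of_indexK (p : program) :
  program_of_index (program_index p) = p.
Proof. apply program_of_fuel_index. lia. Qed.

(* Main.v *)
Require Import Defs.
From Stdlib Require Import List.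
Import ListNotations.
From Stdlib Require Import Arith Lia Cantor Classical ClassicalEpsilon.

(** Fix a stage-by-stage simulation of all programs and say that the event [k]
    happens for [e] when [k] codes a pair [(x, n)] such that the simulation of
    [{e}(x)] ends exactly at stage [n].  Every element of [W e] causes exactly
    one event, so [e] is in [Fin] iff only finitely many events happen for [e]
    (lemma [Fin_quiet]).

    The universe of the model consists of the pairs [(e, k)].  Let [F] relate
    [(e, i)], [(e, i)] to [(e, i + 1)] only, and, for [i <> j], relate [(e, i)],
    [(e, j)] to [(e, 0)] and to all the [(e, k)] with [i <= k] such that the
    event [k] happens for [e].  From one point [(e, j)] the closure climbs to
    all [(e, k)] with [j <= k]; having at least two points, it then can apply
    [F] to unequal ones, and this defines [(e, 0)] as soon as no event happens
    from [i] on.  Hence it contains [(e, 0)] for [j = 1] iff [e] is in [Fin].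
    The unbounded search for a bound on the events is done by the iteration
    of the closure, the check of the bound by the uniqueness of the solution.

    The language also names every element of the model by a unary relation.
    This makes every copy [N] of the model isomorphic to it through a
    relabelling [g] that is computed from the atomic diagram of [N] by
    search (lemma [relabelling_program]), so that everything transfers to
    copies uniformly.  The closure of an arbitrary set is computed in lemma
    [dcl_relabelling]; both the reduction from [Fin] and the [Sigma02] form of
    the closure follow from it.

    What remains is recursion theory: the simulation must itself be a program,
    which is achieved by a stack machine whose single step is a definition by
    cases on codes (lemma [W_halts_in]), and [Fin] must be [Sigma02]-hard
    (lemma [Fin_hard]), by an explicit s-m-n function. *)

(** * Projections of the pairing and properties of runs *)

Definition pfst (w : nat) : nat := fst (Cantor.of_nat w).
Definition psnd (w : nat) : nat := snd (Cantor.of_nat w).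

Lemma pfst_npair x y : pfst (npair x y) = x.
Proof. unfold pfst, npair. now rewrite Cantor.cancel_of_to. Qed.

Lemma psnd_npair x y : psnd (npair x y) = y.
Proof. unfold psnd, npair. now rewrite Cantor.cancel_of_to. Qed.

Lemma npair_proj w : npair (pfst w) (psnd w) = w.
Proof.
unfold npair, pfst, psnd. rewrite <- surjective_pairing.
apply Cantor.cancel_to_of.
Qed.

Lemma npair_inj x y x' y' : npair x y = npair x' y' -> x = x' /\ y = y'.
Proof.
intros H. split.
- now rewrite <- (pfst_npair x y), H, pfst_npair.
- now rewrite <- (psnd_npair x y), H, psnd_npair.
Qed.

(** The induction principle generated for [runs] gives no hypothesis for the
    runs under the existential quantifier of [runs_mu]. *)
Lemma runs_induction (O : nat -> Prop) (P : program -> nat -> nat -> Prop)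
  (Hzero : forall x, P PZero x 0)
  (Hsucc : forall x, P PSucc x (S x))
  (Hfst : forall x y, P PFst (npair x y) x)
  (Hsnd : forall x y, P PSnd (npair x y) y)
  (Hyes : forall x, O x -> P POracle x 1)
  (Hno : forall x, ~ O x -> P POracle x 0)
  (Hpair : forall p q x y z, P p x y -> P q x z -> P (PPair p q) x (npair y z))
  (Hcomp : forall p q x y z, P q x y -> P p y z -> P (PComp p q) x z)
  (Hrec0 : forall p q x y, P p x y -> P (PRec p q) (npair x 0) y)
  (HrecS : forall p q x n y z, P (PRec p q) (npair x n) y ->
     P q (npair x (npair n y)) z -> P (PRec p q) (npair x (S n)) z)
  (Hmu : forall p x n, P p (npair x n) 0 ->
     (forall k, k < n -> exists y, P p (npair x k) (S y)) -> P (PMu p) x n) :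
  forall p x y, runs O p x y -> P p x y.
Proof.
fix IH 4. intros p x y H. destruct H as
  [x|x|x y|x y|x H|x H|p q x y z H1 H2|p q x y z H1 H2|p q x y H
  |p q x n y z H1 H2|p x n H1 H2].
1-6: auto.
- apply Hpair; apply IH; assumption.
- apply (Hcomp p q x y z); apply IH; assumption.
- apply Hrec0, IH, H.
- apply (HrecS p q x n y z); apply IH; assumption.
- apply Hmu; [apply IH, H1|]. intros k Hk.
  destruct (H2 k Hk) as [y Hy]. exists y. apply IH, Hy.
Qed.

(** The input is a variable because [inversion] would unfold the pairing when
    comparing two inputs of the form [npair x (S n)]. *)
Lemma runs_rec_inv O p q w z :
  runs O (PRec p q) w z ->
  (exists x, w = npair x 0 /\ runs O p x z) \/
  (exists x n y, w = npair x (S n) /\ runs O (PRec p q) (npair x n) y /\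
     runs O q (npair x (npair n y)) z).
Proof. intros H. inversion H; subst; [left|right]; eauto 8. Qed.

Lemma runs_functional O p x y z : runs O p x y -> runs O p x z -> y = z.
Proof.
intros H. revert z. revert p x y H.
apply (runs_induction O (fun p x y => forall z, runs O p x z -> y = z)).
- intros x z H. now inversion H.
- intros x z H. now inversion H.
- intros x y z H. inversion H; subst. match goal with
  E : npair _ _ = npair _ _ |- _ => apply npair_inj in E; now destruct E end.
- intros x y z H. inversion H; subst. match goal with
  E : npair _ _ = npair _ _ |- _ => apply npair_inj in E; now destruct E end.
- intros x Hx z H. now inversion H.
- intros x Hx z H. now inversion H.
- intros p q x y z IHp IHq w H. inversion H; subst. f_equal; auto.
- intros p q x y z IHq IHp w H. inversion H; subst. apply IHp.
  erewrite IHq; eassumption.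
- intros p q x y IHp w H.
  apply runs_rec_inv in H as [(x' & E & H)|(x' & n' & y' & E & _)];
    apply npair_inj in E; destruct E as [-> E]; [auto|discriminate].
- intros p q x n y z IHr IHq w H.
  apply runs_rec_inv in H as [(x' & E & _)|(x' & n' & y' & E & Hr & Hq)];
    apply npair_inj in E; destruct E as [-> E]; [discriminate|].
  injection E as ->. apply IHq. erewrite IHr; eassumption.
- intros p x n IH0 IHS w H. inversion H as [| | | | | | | | | |? ? ? H0 HS E1 E2]; subst.
  destruct (lt_eq_lt_dec n w) as [[Hlt|E]|Hlt]; [|exact E|].
  + destruct (HS n Hlt) as [y Hy]. apply IH0 in Hy. discriminate.
  + destruct (IHS w Hlt) as [y Hy]. apply Hy in H0. discriminate.
Qed.

(** * Functions computable under every oracle *)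

Fixpoint subst_oracle (d p : program) : program :=
  match p with
  | POracle => d
  | PPair p q => PPair (subst_oracle d p) (subst_oracle d q)
  | PComp p q => PComp (subst_oracle d p) (subst_oracle d q)
  | PRec p q => PRec (subst_oracle d p) (subst_oracle d q)
  | PMu p => PMu (subst_oracle d p)
  | p => p
  end.

Lemma runs_subst_oracle (O O' : nat -> Prop) (d : program) :
  (forall x, O x -> runs O' d x 1) -> (forall x, ~ O x -> runs O' d x 0) ->
  forall p x y, runs O p x y -> runs O' (subst_oracle d p) x y.
Proof.
intros Hyes Hno.
apply (runs_induction O (fun p x y => runs O' (subst_oracle d p) x y));
  cbn; intros; try (econstructor; eassumption); auto; constructor; auto.
Qed.

(** The program must work under all oracles at once, so that the functions of
    this class can be used inside computations relative to any structure. *)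
Definition computable (f : nat -> nat) : Prop :=
  exists p, forall O x, runs O p x (f x).

Definition computable_pred (b : nat -> bool) : Prop :=
  computable (fun x => Nat.b2n (b x)).

Lemma computable_ext f g :
  (forall x, f x = g x) -> computable f -> computable g.
Proof. intros E [p Hp]. exists p. intros O x. rewrite <- E. apply Hp. Qed.

Lemma computable_id : computable (fun x => x).
Proof.
exists (PPair PFst PSnd). intros O x.
rewrite <- (npair_proj x). repeat constructor.
Qed.

Lemma computable_comp f g :
  computable f -> computable g -> computable (fun x => f (g x)).
Proof.
intros [p Hp] [q Hq]. exists (PComp p q). intros O x. econstructor; auto.
Qed.

Lemma computable_succ f : computable f -> computable (fun x => S (f x)).
Proof. apply (computable_comp S). exists PSucc. constructor. Qed.

Lemma computable_pfst f : computable f -> computable (fun x => pfst (f x)).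
Proof.
apply (computable_comp pfst). exists PFst. intros O x.
rewrite <- (npair_proj x), pfst_npair. constructor.
Qed.

Lemma computable_psnd f : computable f -> computable (fun x => psnd (f x)).
Proof.
apply (computable_comp psnd). exists PSnd. intros O x.
rewrite <- (npair_proj x), psnd_npair. constructor.
Qed.

Lemma computable_npair f g :
  computable f -> computable g -> computable (fun x => npair (f x) (g x)).
Proof. intros [p Hp] [q Hq]. exists (PPair p q). constructor; auto. Qed.

Fixpoint const_program (k : nat) : program :=
  match k with
  | 0 => PZero
  | S k => PComp PSucc (const_program k)
  end.

Lemma runs_const_program O k x : runs O (const_program k) x k.
Proof. induction k; cbn; econstructor; eauto. constructor. Qed.

Lemma computable_const k : computable (fun _ => k).
Proof. exists (const_program k). intros. apply runs_const_program. Qed.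

Create HintDb computable.
#[local] Hint Constants Opaque : computable.
#[local] Hint Resolve computable_id computable_const | 0 : computable.
#[local] Hint Resolve computable_succ computable_pfst computable_psnd computable_npair
  : computable.

Lemma computable_rec a s n :
  computable a ->
  computable (fun w => s (pfst w) (pfst (psnd w)) (psnd (psnd w))) ->
  computable n ->
  computable (fun x => nat_rect (fun _ => nat) (a x) (s x) (n x)).
Proof.
intros [p Hp] [q Hq] Hn.
assert (H : computable (fun x => npair x (n x))) by auto with computable.
destruct H as [r Hr]. exists (PComp (PRec p q) r). intros O x.
apply runs_comp with (npair x (n x)); [apply Hr|].
induction (n x) as [|m IH]; cbn.
- constructor. apply Hp.
- econstructor; [exact IH|].
  match goal with |- runs _ _ ?i _ => specialize (Hq O i) end.
  now rewrite !psnd_npair, !pfst_npair in Hq.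
Qed.

Lemma computable_iter f n a :
  computable f -> computable n -> computable a ->
  computable (fun x => Nat.iter (n x) f (a x)).
Proof.
intros Hf Hn Ha. apply (computable_rec a (fun _ _ y => f y) n); auto.
apply (computable_comp f); auto with computable.
Qed.

Lemma computable_if b f g :
  computable_pred b -> computable f -> computable g ->
  computable (fun x => if b x then f x else g x).
Proof.
intros Hb Hf Hg.
apply computable_ext with
  (fun x => nat_rect (fun _ => nat) (g x) (fun _ _ => f x) (Nat.b2n (b x))).
- intros x. now destruct (b x).
- apply (computable_rec g (fun x _ _ => f x)); auto.
  apply (computable_comp f); auto with computable.
Qed.

Lemma computable_pred_eq0 f :
  computable f -> computable_pred (fun x => f x =? 0).
Proof.
intros Hf. apply computable_ext with
  (fun x => nat_rect (fun _ => nat) 1 (fun _ _ => 0) (f x)).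
- intros x. now destruct (f x).
- apply (computable_rec (fun _ => 1) (fun _ _ _ => 0)); auto with computable.
Qed.

Lemma computable_npred f : computable f -> computable (fun x => Nat.pred (f x)).
Proof.
intros Hf. apply computable_ext with
  (fun x => nat_rect (fun _ => nat) 0 (fun n _ => n) (f x)).
- intros x. now destruct (f x).
- apply (computable_rec (fun _ => 0) (fun _ n _ => n)); auto with computable.
Qed.

#[local] Hint Resolve computable_if computable_pred_eq0 computable_npred : computable.

Lemma computable_add f g :
  computable f -> computable g -> computable (fun x => f x + g x).
Proof.
intros Hf Hg. apply computable_ext with (fun x => Nat.iter (g x) S (f x)).
- intros x. induction (g x) as [|n IH]; [cbn; lia|]. rewrite Nat.iter_succ, IH. lia.
- apply computable_iter; auto with computable.
Qed.

Lemma computable_sub f g :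
  computable f -> computable g -> computable (fun x => f x - g x).
Proof.
intros Hf Hg. apply computable_ext with (fun x => Nat.iter (g x) Nat.pred (f x)).
- intros x. induction (g x) as [|n IH]; [cbn; lia|]. rewrite Nat.iter_succ, IH. lia.
- apply computable_iter; auto with computable.
Qed.

#[local] Hint Resolve computable_add computable_sub : computable.

Lemma computable_pow2 f : computable f -> computable (fun x => 2 ^ f x).
Proof.
intros Hf. apply computable_ext with
  (fun x => Nat.iter (f x) (fun y => y + y) 1).
- intros x. induction (f x) as [|n IH]; [reflexivity|].
  rewrite Nat.iter_succ, IH. cbn. lia.
- apply computable_iter; auto with computable.
Qed.

Lemma computable_pred_ext b c :
  (forall x, b x = c x) -> computable_pred b -> computable_pred c.
Proof. intros E. apply computable_ext. intros x. now rewrite E. Qed.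

Lemma computable_pred_comp b f :
  computable_pred b -> computable f -> computable_pred (fun x => b (f x)).
Proof. intros Hb Hf. exact (computable_comp _ f Hb Hf). Qed.

Lemma computable_pred_if b c d :
  computable_pred b -> computable_pred c -> computable_pred d ->
  computable_pred (fun x => if b x then c x else d x).
Proof.
intros Hb Hc Hd.
apply (computable_ext (fun x => if b x then Nat.b2n (c x) else Nat.b2n (d x))).
- intros x. now destruct (b x).
- now apply computable_if.
Qed.

Lemma computable_pred_const b : computable_pred (fun _ => b).
Proof. exact (computable_const (Nat.b2n b)). Qed.

#[local] Hint Resolve computable_pow2 computable_pred_if : computable.
#[local] Hint Resolve computable_pred_const | 0 : computable.

Lemma computable_pred_and b c :
  computable_pred b -> computable_pred c ->
  computable_pred (fun x => b x && c x)%bool.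
Proof. unfold andb. auto with computable. Qed.

Lemma computable_pred_or b c :
  computable_pred b -> computable_pred c ->
  computable_pred (fun x => b x || c x)%bool.
Proof. unfold orb. auto with computable. Qed.

Lemma computable_pred_not b :
  computable_pred b -> computable_pred (fun x => negb (b x)).
Proof. unfold negb. auto with computable. Qed.

Lemma computable_pred_leb f g :
  computable f -> computable g -> computable_pred (fun x => f x <=? g x).
Proof.
intros Hf Hg. apply computable_pred_ext with (fun x => f x - g x =? 0).
- intros x. apply Bool.eq_iff_eq_true.
  rewrite Nat.eqb_eq, Nat.leb_le. lia.
- auto with computable.
Qed.

#[local] Hint Resolve computable_pred_and computable_pred_or computable_pred_not
  computable_pred_leb : computable.

Lemma computable_pred_eqb f g :
  computable f -> computable g -> computable_pred (fun x => f x =? g x).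
Proof.
intros Hf Hg.
apply computable_pred_ext with (fun x => (f x <=? g x) && (g x <=? f x))%bool.
- intros x. apply Bool.eq_iff_eq_true.
  rewrite Bool.andb_true_iff, Nat.eqb_eq, !Nat.leb_le. lia.
- auto with computable.
Qed.

Lemma computable_pred_odd f :
  computable f -> computable_pred (fun x => Nat.odd (f x)).
Proof.
intros Hf. apply (computable_ext (fun x => Nat.iter (f x) (fun y => 1 - y) 0)).
- intros x. induction (f x) as [|n IH]; [reflexivity|].
  cbn [Nat.iter nat_rect]. rewrite Nat.odd_succ, <- Nat.negb_odd.
  change (nat_rect _ _ _ n) with (Nat.iter n (fun y => 1 - y) 0).
  rewrite IH. now destruct (Nat.odd n).
- apply computable_iter; auto with computable.
Qed.

#[local] Hint Resolve computable_pred_eqb computable_pred_odd : computable.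

Lemma computable_div2 f : computable f -> computable (fun x => Nat.div2 (f x)).
Proof.
intros Hf. apply computable_ext with
  (fun x => nat_rect (fun _ => nat) 0
     (fun n y => if Nat.odd n then S y else y) (f x)).
- intros x. induction (f x) as [|n IH]; [reflexivity|]. cbn [nat_rect].
  rewrite IH. pose proof (Nat.div2_odd n) as Hn.
  pose proof (Nat.div2_odd (S n)) as HS.
  rewrite Nat.odd_succ, <- Nat.negb_odd in HS.
  destruct (Nat.odd n); cbn [Nat.b2n negb] in *; lia.
- apply (computable_rec (fun _ => 0)
    (fun _ n y => if Nat.odd n then S y else y)); auto with computable.
Qed.

#[local] Hint Resolve computable_div2 : computable.

Lemma computable_pred_testbit f g :
  computable f -> computable g ->
  computable_pred (fun x => Nat.testbit (f x) (g x)).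
Proof.
intros Hf Hg.
apply computable_pred_ext with (fun x => Nat.odd (Nat.iter (g x) Nat.div2 (f x))).
- intros x. generalize (f x). induction (g x) as [|n IH]; intros u.
  + reflexivity.
  + rewrite Nat.iter_succ_r, IH. reflexivity.
- apply computable_pred_odd, computable_iter; auto with computable.
Qed.

#[local] Hint Resolve computable_pred_testbit : computable.

Lemma decides_computable_pred b A :
  computable_pred b -> (forall x, b x = true <-> A x) -> exists e, decides e A.
Proof.
intros [p Hp] HA. exists (program_index p). intros x.
unfold phi. rewrite program_of_indexK.
specialize (Hp no_oracle x). specialize (HA x).
destruct (b x); cbn in Hp; [left|right]; (split; [|exact Hp]).
- tauto.
- intros H. apply HA in H. discriminate.
Qed.

(** A decision procedure for the empty oracle becomes independent of the oracle
    when every question to the oracle is replaced by the answer [0]. *)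
Lemma computable_pred_decides e A :
  decides e A -> exists b, computable_pred b /\ forall x, b x = true <-> A x.
Proof.
intros He.
exists (fun x => if excluded_middle_informative (A x) then true else false).
split.
- exists (subst_oracle PZero (program_of_index e)). intros O x.
  apply (runs_subst_oracle no_oracle).
  + intros y [].
  + intros y _. constructor.
  + destruct (He x) as [[HA Hx]|[HA Hx]];
      destruct (excluded_middle_informative (A x)); cbn; tauto.
- intros x. destruct (excluded_middle_informative (A x)); [tauto|].
  split; [discriminate|tauto].
Qed.

(** * A stack machine running all programs *)

(** A state [npair v K] consists of a value [v] and a stack [K] of tasks that
    transform this value; the machine has halted when the stack is [0], the
    empty one.  Next to running an index there are three tasks:
    [task_right q x], to run [q] on [x] once the left component of a pair is
    known; [task_prepend y], to form a pair with left component [y]; and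
    [task_search p x n], to continue a minimization according to the value of
    [p] at [npair x n]. *)
Definition push (t K : nat) : nat := S (npair t K).
Definition task_run (e : nat) : nat := npair 0 e.
Definition task_right (q x : nat) : nat := npair 1 (npair q x).
Definition task_prepend (y : nat) : nat := npair 2 y.
Definition task_search (p x n : nat) : nat := npair 3 (npair p (npair x n)).

Definition quarter (m : nat) : nat := Nat.div2 (Nat.div2 m).

Definition start_program (e v K : nat) : nat :=
  if e =? 0 then npair 0 K
  else if e =? 1 then npair (S v) K
  else if e =? 2 then npair (pfst v) K
  else if e =? 3 then npair (psnd v) K
  else if e =? 4 then npair 0 K
  else
    let l := quarter (e - 5) in
    let r := (e - 5) - (l + l + l + l) in
    if r =? 0 then
      npair v (push (task_run (pfst l)) (push (task_right (psnd l) v) K))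
    else if r =? 1 then
      npair v (push (task_run (psnd l)) (push (task_run (pfst l)) K))
    else if r =? 2 then
      if psnd v =? 0 then npair (pfst v) (push (task_run (pfst l)) K)
      else
        let n := Nat.pred (psnd v) in
        npair (npair (pfst v) n)
          (push (task_run e)
            (push (task_prepend n)
              (push (task_prepend (pfst v)) (push (task_run (psnd l)) K))))
    else npair (npair v 0) (push (task_run l) (push (task_search l v 0) K)).

Definition perform (tag d v K : nat) : nat :=
  if tag =? 0 then start_program d v K
  else if tag =? 1 then
    npair (psnd d) (push (task_run (pfst d)) (push (task_prepend v) K))
  else if tag =? 2 then npair (npair d v) K
  else
    let p := pfst d in let x := pfst (psnd d) in let n := psnd (psnd d) in
    if v =? 0 then npair n K
    else npair (npair x (S n)) (push (task_run p) (push (task_search p x (S n)) K)).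

Definition machine_step (s : nat) : nat :=
  if psnd s =? 0 then s
  else
    let w := Nat.pred (psnd s) in
    perform (pfst (pfst w)) (psnd (pfst w)) (pfst s) (psnd w).

Lemma computable_machine_step f :
  computable f -> computable (fun x => machine_step (f x)).
Proof.
apply (computable_comp machine_step).
unfold machine_step, perform, start_program, push, task_run, task_right,
  task_prepend, task_search, quarter.
auto 40 with computable.
Qed.

Definition halts_in (n s : nat) : Prop := psnd (Nat.iter n machine_step s) = 0.

Lemma quarter_eq q r : r < 4 -> quarter (r + 4 * q) = q.
Proof.
intros Hr. unfold quarter. rewrite !Nat.div2_div, Nat.Div0.div_div.
change (2 * 2) with 4. rewrite (Nat.mul_comm 4 q), Nat.div_add, Nat.div_small; lia.
Qed.

Lemma program_of_fuel_stable k k' e :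
  e < k -> e < k' -> program_of_fuel k e = program_of_fuel k' e.
Proof.
revert k' e. induction k as [|k IH]; intros [|k'] e Hk Hk'; try lia.
destruct e as [|[|[|[|[|m]]]]]; try reflexivity. cbn [program_of_fuel].
assert (Hm : m / 4 <= m) by (apply Nat.Div0.div_le_upper_bound; lia).
pose proof (npair_le (pfst (m / 4)) (psnd (m / 4))) as Hle.
rewrite npair_proj in Hle. unfold pfst, psnd in Hle.
rewrite (IH k' (fst _)), (IH k' (snd _)), (IH k' (m / 4)) by lia.
reflexivity.
Qed.

(** The case distinction of [start_program] on an index, with the program that
    the index stands for. *)
Inductive index_view : nat -> program -> Prop :=
| view_zero : index_view 0 PZero
| view_succ : index_view 1 PSucc
| view_fst : index_view 2 PFst
| view_snd : index_view 3 PSnd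
| view_oracle : index_view 4 POracle
| view_pair l : index_view (5 + (0 + 4 * l))
    (PPair (program_of_index (pfst l)) (program_of_index (psnd l)))
| view_comp l : index_view (5 + (1 + 4 * l))
    (PComp (program_of_index (pfst l)) (program_of_index (psnd l)))
| view_rec l : index_view (5 + (2 + 4 * l))
    (PRec (program_of_index (pfst l)) (program_of_index (psnd l)))
| view_mu l : index_view (5 + (3 + 4 * l)) (PMu (program_of_index l)).

Lemma program_of_fuel_compound k m :
  program_of_fuel (S k) (5 + m) =
  match m mod 4 with
  | 0 => PPair (program_of_fuel k (pfst (m / 4))) (program_of_fuel k (psnd (m / 4)))
  | 1 => PComp (program_of_fuel k (pfst (m / 4))) (program_of_fuel k (psnd (m / 4)))
  | 2 => PRec (program_of_fuel k (pfst (m / 4))) (program_of_fuel k (psnd (m / 4)))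
  | _ => PMu (program_of_fuel k (m / 4))
  end.
Proof. reflexivity. Qed.

Lemma index_viewP e : index_view e (program_of_index e).
Proof.
destruct e as [|[|[|[|[|m]]]]]; try constructor.
change (S (S (S (S (S m))))) with (5 + m).
assert (Hm : m / 4 <= m) by (apply Nat.Div0.div_le_upper_bound; lia).
pose proof (npair_le (pfst (m / 4)) (psnd (m / 4))) as Hle.
rewrite npair_proj in Hle.
assert (Hf : forall e, e <= m / 4 -> program_of_fuel (5 + m) e = program_of_index e).
{ intros e He. apply program_of_fuel_stable; lia. }
unfold program_of_index. rewrite program_of_fuel_compound, !Hf by lia.
pose proof (Nat.mod_upper_bound m 4 ltac:(lia)) as Hr.
pose proof (Nat.div_mod_eq m 4) as E. revert E Hr.
generalize (m mod 4) (m / 4). intros r l E Hr.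
assert (m = r + 4 * l) as -> by lia.
destruct r as [|[|[|[|r]]]]; [constructor..|lia].
Qed.

Lemma step_run e v K :
  machine_step (npair v (push (task_run e) K)) = start_program e v K.
Proof.
unfold machine_step, push, task_run. rewrite psnd_npair. cbn [Nat.eqb Nat.pred].
rewrite !psnd_npair, !pfst_npair, ?psnd_npair. unfold perform.
cbn [Nat.eqb]. now rewrite ?psnd_npair, ?pfst_npair, ?psnd_npair.
Qed.

Lemma step_right q x v K :
  machine_step (npair v (push (task_right q x) K)) =
  npair x (push (task_run q) (push (task_prepend v) K)).
Proof.
unfold machine_step, push, task_right. rewrite psnd_npair. cbn [Nat.eqb Nat.pred].
rewrite !psnd_npair, !pfst_npair, ?psnd_npair. unfold perform.
cbn [Nat.eqb]. now rewrite ?psnd_npair, ?pfst_npair, ?psnd_npair.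
Qed.

Lemma step_prepend y v K :
  machine_step (npair v (push (task_prepend y) K)) = npair (npair y v) K.
Proof.
unfold machine_step, push, task_prepend. rewrite psnd_npair. cbn [Nat.eqb Nat.pred].
rewrite !psnd_npair, !pfst_npair, ?psnd_npair. unfold perform.
cbn [Nat.eqb]. now rewrite ?psnd_npair, ?pfst_npair, ?psnd_npair.
Qed.

Lemma step_search p x n v K :
  machine_step (npair v (push (task_search p x n) K)) =
  if v =? 0 then npair n K
  else npair (npair x (S n)) (push (task_run p) (push (task_search p x (S n)) K)).
Proof.
unfold machine_step, push, task_search. rewrite psnd_npair. cbn [Nat.eqb Nat.pred].
rewrite !psnd_npair, !pfst_npair, ?psnd_npair. unfold perform.
cbn [Nat.eqb]. now rewrite ?psnd_npair, ?pfst_npair, ?psnd_npair.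
Qed.

Lemma start_compound r l v K :
  r < 4 ->
  start_program (5 + (r + 4 * l)) v K =
  match r with
  | 0 => npair v (push (task_run (pfst l)) (push (task_right (psnd l) v) K))
  | 1 => npair v (push (task_run (psnd l)) (push (task_run (pfst l)) K))
  | 2 =>
    if psnd v =? 0 then npair (pfst v) (push (task_run (pfst l)) K)
    else
      npair (npair (pfst v) (Nat.pred (psnd v)))
        (push (task_run (5 + (r + 4 * l)))
          (push (task_prepend (Nat.pred (psnd v)))
            (push (task_prepend (pfst v)) (push (task_run (psnd l)) K))))
  | _ => npair (npair v 0) (push (task_run l) (push (task_search l v 0) K))
  end.
Proof.
intros Hr. unfold start_program.
replace (5 + (r + 4 * l) - 5) with (r + 4 * l) by lia.
rewrite quarter_eq by exact Hr. cbv zeta.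
replace (r + 4 * l - (l + l + l + l)) with r by lia.
cbn [Nat.add Nat.eqb].
destruct r as [|[|[|[|r]]]]; try lia; reflexivity.
Qed.

Definition reaches (s t : nat) : Prop := exists n, Nat.iter n machine_step s = t.

Lemma reaches_step s t : reaches (machine_step s) t -> reaches s t.
Proof. intros [n H]. exists (S n). now rewrite Nat.iter_succ_r. Qed.

Lemma reaches_refl s : reaches s s.
Proof. now exists 0. Qed.

Lemma reaches_trans s t u : reaches s t -> reaches t u -> reaches s u.
Proof. intros [n <-] [m <-]. exists (m + n). apply Nat.iter_add. Qed.

Lemma reaches_search e x K k n :
  k <= n ->
  (forall j, k <= j -> j < n -> exists y, forall K,
     reaches (npair (npair x j) (push (task_run e) K)) (npair (S y) K)) ->
  (forall K, reaches (npair (npair x n) (push (task_run e) K)) (npair 0 K)) ->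
  reaches (npair (npair x k) (push (task_run e) (push (task_search e x k) K)))
    (npair n K).
Proof.
intros Hk HS H0. remember (n - k) as d eqn:Hd. revert k Hk HS Hd.
induction d as [|d IH]; intros k Hk HS Hd.
- assert (k = n) as -> by lia. eapply reaches_trans; [apply H0|].
  apply reaches_step. rewrite step_search. apply reaches_refl.
- destruct (HS k) as [y Hy]; [lia..|].
  eapply reaches_trans; [apply Hy|].
  apply reaches_step. rewrite step_search. cbn [Nat.eqb].
  apply IH; [lia| |lia]. intros j Hj Hn. apply HS; lia.
Qed.

(** The machine stops on every converging computation; the stack [K] below is
    arbitrary because subcomputations run on top of pending tasks. *)
Lemma machine_complete p x y :
  runs no_oracle p x y ->
  forall e, program_of_index e = p -> forall K,
  reaches (npair x (push (task_run e) K)) (npair y K).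
Proof.
revert p x y. apply (runs_induction no_oracle (fun p x y =>
  forall e, program_of_index e = p -> forall K,
  reaches (npair x (push (task_run e) K)) (npair y K))).
all: intros; apply reaches_step; rewrite step_run;
  match goal with E : program_of_index ?e = _ |- _ =>
    pose proof (index_viewP e) as V; rewrite E in V; inversion V; subst;
    try rewrite start_compound by lia; cbn [Nat.eqb] end.
- apply reaches_refl.
- apply reaches_refl.
- unfold start_program; cbn [Nat.eqb]. rewrite pfst_npair. apply reaches_refl.
- unfold start_program; cbn [Nat.eqb]. rewrite psnd_npair. apply reaches_refl.
- contradiction.
- apply reaches_refl.
- eapply reaches_trans; [apply H; reflexivity|].
  apply reaches_step. rewrite step_right.
  eapply reaches_trans; [apply H0; reflexivity|].
  apply reaches_step. rewrite step_prepend. apply reaches_refl.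
- eapply reaches_trans; [apply H; reflexivity|]. now apply H0.
- rewrite psnd_npair, pfst_npair. cbn [Nat.eqb]. now apply H.
- rewrite psnd_npair, pfst_npair. cbn [Nat.eqb Nat.pred].
  eapply reaches_trans; [apply H; assumption|].
  apply reaches_step. rewrite step_prepend.
  apply reaches_step. rewrite step_prepend. now apply H0.
- apply reaches_search; [lia| |].
  + intros j _ Hj. destruct (H0 j Hj) as [y Hy]. exists y. now apply Hy.
  + now apply H.
Qed.

Lemma halts_in_step n s :
  psnd s <> 0 -> halts_in n s ->
  exists m, n = S m /\ halts_in m (machine_step s).
Proof.
intros Hs H. destruct n as [|n]; [contradiction|].
exists n. split; [reflexivity|]. unfold halts_in in *.
now rewrite Nat.iter_succ_r in H.
Qed.

(** Halting within fewer than [n] steps is only possible by first finishing the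
    topmost run; this is proved by induction on [n], and the bound [l < m] on
    the rest of the computation allows to treat the pending tasks in turn. *)
Definition returns (n : nat) : Prop := forall m e x K,
  m < n -> halts_in m (npair x (push (task_run e) K)) ->
  exists y l, l < m /\ runs no_oracle (program_of_index e) x y /\
    halts_in l (npair y K).

Lemma push_neq0 v t K : psnd (npair v (push t K)) <> 0.
Proof. rewrite psnd_npair. discriminate. Qed.

Lemma search_returns n e x K k m :
  returns n -> m < n ->
  (forall j, j < k ->
     exists y, runs no_oracle (program_of_index e) (npair x j) (S y)) ->
  halts_in m
    (npair (npair x k) (push (task_run e) (push (task_search e x k) K))) ->
  exists y l, l < m /\ runs no_oracle (PMu (program_of_index e)) x y /\
    halts_in l (npair y K).
Proof.
intros Hn. revert k. induction m as [m IH] using lt_wf_ind. intros k Hm Hk H.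
apply Hn in H as (y & l & Hl & Hr & H); [|exact Hm].
apply halts_in_step in H as (l' & -> & H); [|apply push_neq0].
rewrite step_search in H. destruct y as [|y]; cbn [Nat.eqb] in H.
- exists k, l'. repeat split; [lia| |exact H]. now constructor.
- apply IH in H as (z & l'' & Hl'' & H); [|lia|lia|].
  + exists z, l''. split; [lia|exact H].
  + intros j Hj. destruct (Nat.eq_dec j k) as [->|Hne]; [eauto|].
    apply Hk. lia.
Qed.

Lemma machine_sound n : returns n.
Proof.
induction n as [|n IH]; [intros m e x K Hm; lia|].
intros m e x K Hm H.
apply halts_in_step in H as (l & -> & H); [|apply push_neq0].
rewrite step_run in H.
assert (Hl : l < n) by lia. clear Hm.
pose proof (index_viewP e) as V.
remember (program_of_index e) as P eqn:HP.
destruct V; try rewrite start_compound in H by lia.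
- exists 0, l. repeat split; [lia|constructor|exact H].
- exists (S x), l. repeat split; [lia|constructor|exact H].
- exists (pfst x), l. repeat split; [lia| |exact H].
  rewrite <- (npair_proj x) at 1. constructor.
- exists (psnd x), l. repeat split; [lia| |exact H].
  rewrite <- (npair_proj x) at 1. constructor.
- exists 0, l. repeat split; [lia|now constructor|exact H].
- apply IH in H as (y & l1 & Hl1 & Hy & H); [|exact Hl].
  apply halts_in_step in H as (l2 & -> & H); [|apply push_neq0].
  rewrite step_right in H.
  apply IH in H as (z & l3 & Hl3 & Hz & H); [|lia].
  apply halts_in_step in H as (l4 & -> & H); [|apply push_neq0].
  rewrite step_prepend in H.
  exists (npair y z), l4. repeat split; [lia|now constructor|exact H].
- apply IH in H as (y & l1 & Hl1 & Hy & H); [|exact Hl].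
  apply IH in H as (z & l3 & Hl3 & Hz & H); [|lia].
  exists z, l3. repeat split; [lia|econstructor; eassumption|exact H].
- rewrite <- (npair_proj x). destruct (psnd x) as [|k]; cbn [Nat.eqb Nat.pred] in H.
  + apply IH in H as (y & l1 & Hl1 & Hy & H); [|exact Hl].
    exists y, l1. repeat split; [lia|now constructor|exact H].
  + apply IH in H as (y & l1 & Hl1 & Hy & H); [|exact Hl].
    apply halts_in_step in H as (l2 & -> & H); [|apply push_neq0].
    rewrite step_prepend in H.
    apply halts_in_step in H as (l3 & -> & H); [|apply push_neq0].
    rewrite step_prepend in H.
    apply IH in H as (z & l4 & Hl4 & Hz & H); [|lia].
    exists z, l4. repeat split; [lia| |exact H].
    rewrite <- HP in Hy. econstructor; eassumption.
- apply (search_returns n) in H as (y & l1 & Hl1 & H); [|exact IH|exact Hl|lia].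
  exists y, l1. split; [lia|exact H].
Qed.

Definition initial_state (e x : nat) : nat := npair x (push (task_run e) 0).

Lemma W_halts_in e x : W e x <-> exists n, halts_in n (initial_state e x).
Proof.
split.
- intros [y Hy].
  destruct (machine_complete _ _ _ Hy e eq_refl 0) as [n Hn].
  exists n. unfold halts_in, initial_state. now rewrite Hn, psnd_npair.
- intros [n Hn].
  destruct (machine_sound (S n) n e x 0) as (y & _ & _ & Hy & _); [lia|exact Hn|].
  now exists y.
Qed.

(** The event [k = npair x n] for [e]: the first halted state in the simulation
    of [{e}(x)] is the one after [n + 1] steps.  The initial state is never
    halted, so every halting simulation has such an [n], and it has only one. *)
Definition halts_at (e k : nat) : bool :=
  negb (psnd (Nat.iter (psnd k) machine_step (initial_state e (pfst k))) =? 0)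
  && (psnd (Nat.iter (S (psnd k)) machine_step (initial_state e (pfst k))) =? 0).

Lemma computable_halts_at f g :
  computable f -> computable g -> computable_pred (fun x => halts_at (f x) (g x)).
Proof.
intros Hf Hg. unfold halts_at, initial_state, push, task_run.
assert (Hs : computable machine_step)
  by (apply (computable_machine_step (fun x => x)), computable_id).
apply computable_pred_and.
- apply computable_pred_not, computable_pred_eq0, computable_psnd, computable_iter;
    auto 10 with computable.
- apply computable_pred_eq0, computable_psnd.
  apply (computable_iter machine_step (fun x => S (psnd (g x))));
    auto 10 with computable.
Qed.

Lemma halts_in_mono n m s : n <= m -> halts_in n s -> halts_in m s.
Proof.
unfold halts_in. intros Hle H. induction Hle as [|m _ IH]; [exact H|].
rewrite Nat.iter_succ. unfold machine_step at 1. now rewrite IH.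
Qed.

Lemma halts_atP e k :
  halts_at e k = true <->
  ~ halts_in (psnd k) (initial_state e (pfst k)) /\
  halts_in (S (psnd k)) (initial_state e (pfst k)).
Proof.
unfold halts_at, halts_in.
now rewrite Bool.andb_true_iff, Bool.negb_true_iff, Nat.eqb_neq, Nat.eqb_eq.
Qed.

Definition quiet (e : nat) : Prop :=
  exists i, forall k, i <= k -> halts_at e k = false.

Lemma W_halts_at e x : W e x <-> exists n, halts_at e (npair x n) = true.
Proof.
rewrite W_halts_in. split.
- intros [n Hn]. induction n as [|n IH].
  + exfalso. revert Hn. apply push_neq0.
  + destruct (classic (halts_in n (initial_state e x))) as [H|H]; [auto|].
    exists n. apply halts_atP. now rewrite psnd_npair, pfst_npair.
- intros [n Hn]. apply halts_atP in Hn as [_ Hn].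
  rewrite pfst_npair in Hn. eauto.
Qed.

Lemma halts_at_functional e x n m :
  halts_at e (npair x n) = true -> halts_at e (npair x m) = true -> n = m.
Proof.
rewrite !halts_atP, !psnd_npair, !pfst_npair. intros [Hn Hn'] [Hm Hm'].
destruct (lt_eq_lt_dec n m) as [[Hlt|E]|Hlt]; [|exact E|]; exfalso.
- apply Hm. now apply (halts_in_mono (S n)).
- apply Hn. now apply (halts_in_mono (S m)).
Qed.

(** Events correspond bijectively to the elements of [W e]. *)
Lemma Fin_quiet e : Fin e <-> quiet e.
Proof.
split.
- intros [s Hs].
  assert (H : exists i, forall k, i <= k -> In (pfst k) s -> halts_at e k = false).
  { clear Hs. induction s as [|x s [i IH]].
    - now exists 0.
    - assert (Hx : exists j, forall n, j <= npair x n ->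
        halts_at e (npair x n) = false).
      { destruct (classic (exists n, halts_at e (npair x n) = true)) as [[n Hn]|Hn].
        - exists (S (npair x n)). intros m Hm.
          destruct (halts_at e (npair x m)) eqn:E; [|reflexivity].
          rewrite (halts_at_functional e x n m Hn E) in Hm. lia.
        - exists 0. intros m _. apply Bool.not_true_is_false.
          intros E. apply Hn. now exists m. }
      destruct Hx as [j Hj]. exists (max i j). intros k Hk [E|Hin].
      + rewrite <- (npair_proj k), <- E. apply Hj. rewrite E, npair_proj. lia.
      + apply IH; [lia|exact Hin]. }
  destruct H as [i Hi]. exists i. intros k Hk.
  destruct (halts_at e k) eqn:E; [|reflexivity].
  rewrite <- E. apply Hi; [exact Hk|]. apply Hs, W_halts_at.
  exists (psnd k). now rewrite npair_proj.
- intros [i Hi]. exists (map pfst (seq 0 i)). intros x Hx.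
  apply W_halts_at in Hx as [n Hn]. apply in_map_iff. exists (npair x n).
  split; [apply pfst_npair|]. apply in_seq.
  destruct (le_lt_dec i (npair x n)) as [Hle|Hlt]; [|lia].
  rewrite Hi in Hn by exact Hle. discriminate.
Qed.

(** * The model *)
Definition model_F (x y z : nat) : bool :=
  (pfst x =? pfst y) && (pfst x =? pfst z) &&
  (if psnd x =? psnd y then psnd z =? S (psnd x)
   else (psnd z =? 0) || (psnd x <=? psnd z) && halts_at (pfst x) (psnd z)).

Definition model_language : language :=
  Language None (Some 1) (fun i => match i with 0 => [0; 0; 0] | _ => [0] end).

Definition model : structure :=
  Structure (fun _ => True) (fun j _ => j = 0)
    (fun i s =>
       match i, s with
       | 0, [x; y; z] => model_F x y z = true
       | S n, [x] => x = n
       | _, _ => False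
       end).

Lemma model_language_ok : is_language model_language.
Proof. intros [|i] _; cbn; repeat constructor. Qed.

Lemma model_ok : is_structure model_language model.
Proof.
split; [|split].
- intros j a ->. cbn. auto.
- intros a _. exists 0. split; [reflexivity|]. now intros j ->.
- intros [|i] s; cbn; destruct s as [|x [|y [|z [|w s]]]]; intros H;
    try contradiction; split; auto; repeat constructor.
Qed.

(** The default value [Nat.pred 0 = 0] makes these projections total; whether
    a number really codes a list of the right length is tested by coding the
    extracted entries again. *)
Definition entry0 (c : nat) : nat := pfst (Nat.pred c).
Definition entry1 (c : nat) : nat := pfst (Nat.pred (psnd (Nat.pred c))).
Definition entry2 (c : nat) : nat :=
  pfst (Nat.pred (psnd (Nat.pred (psnd (Nat.pred c))))).

Definition model_rel (w : nat) : bool :=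
  let c := pfst w in
  if psnd w =? 0 then
    (c =? code_tuple [entry0 c; entry1 c; entry2 c]) &&
    model_F (entry0 c) (entry1 c) (entry2 c)
  else (c =? code_tuple [Nat.pred (psnd w)]).

Lemma computable_model_rel : computable_pred model_rel.
Proof.
unfold model_rel, model_F, code_tuple, entry0, entry1, entry2. cbv zeta.
apply computable_pred_if; [auto with computable| |auto 10 with computable].
apply computable_pred_and; [auto 20 with computable|].
apply computable_pred_and; [auto 20 with computable|].
apply computable_pred_if; [auto 20 with computable..|].
apply computable_pred_or; [auto 20 with computable|].
apply computable_pred_and; [auto 20 with computable|].
apply computable_halts_at; auto 20 with computable.
Qed.

Lemma model_relP w : model_rel w = true <-> rel_diagram model w.
Proof.
unfold model_rel, rel_diagram. cbv zeta. split.
- intros H. destruct (psnd w) as [|i] eqn:Hi; cbn [Nat.eqb] in H.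
  + apply andb_prop in H as [E H]. apply Nat.eqb_eq in E.
    exists [entry0 (pfst w); entry1 (pfst w); entry2 (pfst w)], 0.
    split; [|exact H]. rewrite <- E, <- Hi. symmetry. apply npair_proj.
  + apply Nat.eqb_eq in H.
    exists [i], (S i). split; [|reflexivity].
    cbn [Nat.pred] in H. rewrite <- H, <- Hi. symmetry. apply npair_proj.
- intros (s & i & -> & H). rewrite psnd_npair, pfst_npair.
  destruct i as [|i]; cbn [Nat.eqb].
  + destruct s as [|x [|y [|z [|? ?]]]]; try contradiction.
    assert (E : entry0 (code_tuple [x; y; z]) = x /\
      entry1 (code_tuple [x; y; z]) = y /\ entry2 (code_tuple [x; y; z]) = z).
    { unfold entry0, entry1, entry2. cbn [code_tuple Nat.pred].
      repeat first [rewrite psnd_npair | rewrite pfst_npair | progress cbn [Nat.pred]].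
      auto. }
    destruct E as (-> & -> & ->). now rewrite Nat.eqb_refl.
  + destruct s as [|x [|? ?]]; try contradiction. cbn in H. subst x.
    apply Nat.eqb_refl.
Qed.

Lemma model_CompStr : exists c, CompStr_code c model_language model.
Proof.
assert (Ht : computable (fun i => if i =? 0 then code_tuple [0; 0; 0]
                                  else code_tuple [0]))
  by (apply computable_if; auto with computable).
destruct Ht as [t Ht].
destruct (decides_computable_pred (fun _ => true) (dom model)) as [u Hu];
  [auto with computable|now cbn|].
destruct (decides_computable_pred (fun w => psnd w =? 0) (sort_diagram model))
  as [v Hv]; [auto with computable| |].
{ intros w. rewrite Nat.eqb_eq. unfold sort_diagram. cbn [in_sort model]. split.
  - intros E. exists (pfst w), 0. now rewrite <- E, npair_proj.
  - intros (a & j & -> & ->). apply psnd_npair. }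
destruct (decides_computable_pred _ _ computable_model_rel model_relP) as [r Hr].
set (l := npair (npair 0 2) (program_index t)).
set (s := npair u (npair v r)).
assert (Hc : computable (fun x => if x =? 0 then l else s))
  by auto with computable.
destruct Hc as [c Hc].
exists (program_index c), l, s. unfold phi. rewrite program_of_indexK.
split; [apply (Hc no_oracle 0)|]. split.
- split; [apply model_language_ok|]. exists (program_index t).
  split; [reflexivity|]. intros i _. unfold phi. rewrite program_of_indexK.
  specialize (Ht no_oracle i). now destruct i.
- split; [apply (Hc no_oracle 1)|]. split; [apply model_ok|].
  exists u, v, r. auto.
Qed.

(** * Copies of the model *)

(** [N] is the image of the model under the injection [g]. *)
Record relabelling (N : structure) (g : nat -> nat) : Prop := {
  relabelling_inj : forall i j, g i = g j -> i = j;
  relabelling_dom : forall a, dom N a <-> exists i, a = g i;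
  relabelling_sort : forall a, dom N a -> in_sort N 0 a;
  relabelling_name : forall i a, in_rel N (S i) [a] <-> a = g i;
  relabelling_F : forall a b c, in_rel N 0 [a; b; c] <->
    exists x y z, a = g x /\ b = g y /\ c = g z /\ model_F x y z = true
}.

Lemma copy_relabelling N :
  is_structure model_language N -> isomorphic model_language N model ->
  exists g, relabelling N g.
Proof.
intros (Hsort & Hdom & Hrel) (h & _ & Hinj & Hsurj & Hhs & Hhr).
cbn in Hsurj.
assert (G : forall i, {a | dom N a /\ h a = i}).
{ intros i. apply constructive_indefinite_description. auto. }
set (g := fun i => proj1_sig (G i)).
assert (Hg : forall i, dom N (g i) /\ h (g i) = i).
{ intros i. apply (proj2_sig (G i)). }
assert (Hgh : forall a, dom N a -> a = g (h a)).
{ intros a Ha. apply Hinj; [exact Ha|apply Hg|symmetry; apply Hg]. }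
assert (Hin : forall i s, in_rel N i s <-> Forall (dom N) s /\ in_rel model i (map h s)).
{ intros i s. split.
  - intros H. assert (Hs : Forall (dom N) s).
    { apply Hrel in H as [_ H]. clear -H Hsort.
      induction H; constructor; auto. now apply Hsort in H. }
    split; [exact Hs|]. now apply Hhr.
  - intros [Hs H]. apply Hhr; [exact I|assumption..]. }
exists g. split.
- intros i j E. destruct (Hg i) as [_ <-], (Hg j) as [_ <-]. now rewrite E.
- intros a. split; [intros Ha; exists (h a); auto|].
  intros [i ->]. apply Hg.
- intros a Ha. apply Hhs; [cbn; lia|exact Ha|reflexivity].
- intros i a. rewrite Hin. cbn. split.
  + intros [Ha <-]. apply Forall_inv in Ha. auto.
  + intros ->. split; [repeat constructor|]; apply Hg.
- intros a b c. rewrite Hin. cbn. split.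
  + intros [Hs H]. rewrite !Forall_cons_iff in Hs.
    destruct Hs as (Ha & Hb & Hc & _).
    exists (h a), (h b), (h c). auto.
  + intros (x & y & z & -> & -> & -> & H). split.
    * repeat constructor; apply Hg.
    * destruct (Hg x) as [_ ->], (Hg y) as [_ ->], (Hg z) as [_ ->]. exact H.
Qed.

(** The point [g i] is found by asking for every [a] whether the [i]-th name
    holds of it; minimization looks for the value [0], whence the
    complementation of the answer of the oracle. *)
Lemma relabelling_program :
  exists p, forall N g, relabelling N g ->
    forall i, runs (atomic_diagram N) p i (g i).
Proof.
assert (Hq : computable (fun w =>
    npair 2 (npair (code_tuple [psnd w]) (S (pfst w)))))
  by (cbn [code_tuple]; auto 10 with computable).
destruct Hq as [q Hq].
assert (Hn : computable (fun x => 1 - x)) by auto with computable.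
destruct Hn as [n Hn].
exists (PMu (PComp n (PComp POracle q))). intros N g Hg i.
assert (Hw : forall a, atomic_diagram N
    (npair 2 (npair (code_tuple [a]) (S i))) <-> a = g i).
{ intros a. rewrite <- (relabelling_name N g Hg). split.
  - intros [(v & E & _)|[(v & E & _)|(v & E & H)]];
      apply npair_inj in E as [E1 E2]; try discriminate. subst v.
    destruct H as (s & j & E & H). apply npair_inj in E as [E ->].
    destruct s as [|x [|y s]]; try discriminate; cbn [code_tuple] in E.
    + injection E as E. apply npair_inj in E as [-> _]. exact H.
    + injection E as E. apply npair_inj in E as [_ E]. discriminate.
  - intros H. right. right. eexists. split; [reflexivity|].
    exists [a], (S i). auto. }
assert (Hp : forall a y, (a = g i -> y = 0) -> (a <> g i -> y = 1) ->
    runs (atomic_diagram N) (PComp n (PComp POracle q)) (npair i a) y).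
{ intros a y Heq Hne.
  pose proof (Hq (atomic_diagram N) (npair i a)) as Hr.
  rewrite psnd_npair, pfst_npair in Hr.
  destruct (Nat.eq_dec a (g i)) as [E|E].
  - rewrite (Heq E). apply runs_comp with 1; [|apply (Hn _ 1)].
    eapply runs_comp; [exact Hr|]. constructor. now apply Hw.
  - rewrite (Hne E). apply runs_comp with 0; [|apply (Hn _ 0)].
    eapply runs_comp; [exact Hr|]. constructor. now rewrite Hw. }
constructor.
- now apply Hp.
- intros k Hk. exists 0. apply Hp; [lia|reflexivity].
Qed.

Lemma computable_atomic_diagram L N :
  computable_structure L N ->
  exists b, computable_pred b /\ forall w, b w = true <-> atomic_diagram N w.
Proof.
intros (s & _ & u & v & r & _ & Hu & Hv & Hr).
apply computable_pred_decides in Hu as (bu & Cu & Hu).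
apply computable_pred_decides in Hv as (bv & Cv & Hv).
apply computable_pred_decides in Hr as (br & Cr & Hr).
exists (fun w => if pfst w =? 0 then bu (psnd w)
  else if pfst w =? 1 then bv (psnd w)
  else (pfst w =? 2) && br (psnd w))%bool.
split.
- assert (forall b, computable_pred b -> computable_pred (fun w => b (psnd w))).
  { intros b Cb. apply computable_pred_comp; auto with computable. }
  auto 10 with computable.
- intros w. assert (H : atomic_diagram N w <->
    pfst w = 0 /\ dom N (psnd w) \/ pfst w = 1 /\ sort_diagram N (psnd w) \/
    pfst w = 2 /\ rel_diagram N (psnd w)).
  { rewrite <- (npair_proj w) at 1. generalize (pfst w) (psnd w). intros x y.
    unfold atomic_diagram. split.
    - intros [(z & E & H)|[(z & E & H)|(z & E & H)]];
        apply npair_inj in E as [-> ->]; auto.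
    - intros [(-> & H)|[(-> & H)|(-> & H)]]; eauto 6. }
  rewrite H, <- Hu, <- Hv, <- Hr.
  destruct (pfst w) as [|[|[|x]]]; cbn [Nat.eqb andb]; intuition (lia || discriminate).
Qed.

Lemma computable_relabelling L N g :
  computable_structure L N -> relabelling N g -> computable g.
Proof.
intros HN Hg. apply computable_atomic_diagram in HN as (b & [d Hd] & Hb).
destruct relabelling_program as [p Hp].
exists (subst_oracle d p). intros O x.
apply (runs_subst_oracle (atomic_diagram N)); [| |now apply Hp].
- intros w Hw. apply Hb in Hw. specialize (Hd O w). now rewrite Hw in Hd.
- intros w Hw. specialize (Hd O w). rewrite <- Hb in Hw.
  now destruct (b w).
Qed.

(** * Definable closure in copies of the model *)
Lemma cl_le Phi N B m n b : m <= n -> cl Phi N m B b -> cl Phi N n B b.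
Proof. intros Hle Hb. induction Hle; [exact Hb|]. now left. Qed.

Lemma psat_F N a d :
  is_structure model_language N ->
  psat N (ternary_pformula 0 0 0 0) a d <->
  exists x y z, a = [x; y] /\ d = [z] /\ in_rel N 0 [x; y; z].
Proof.
intros (_ & _ & Hrel). unfold psat, has_type. cbn [xpart ypart body ternary_pformula].
split.
- intros (Ha & Hd & H).
  apply Forall2_length in Ha, Hd.
  destruct a as [|x [|y [|? ?]]]; try discriminate Ha.
  destruct d as [|z [|? ?]]; try discriminate Hd.
  exists x, y, z. repeat split. exact H.
- intros (x & y & z & -> & -> & H). pose proof H as Hs.
  apply Hrel in Hs as [_ Hs]. cbn in Hs.
  inversion Hs as [|? ? ? ? Hx Hs1]; subst. inversion Hs1 as [|? ? ? ? Hy Hs2]; subst.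
  inversion Hs2 as [|? ? ? ? Hz _]; subst.
  split; [|split; [|exact H]]; repeat constructor; assumption.
Qed.

Lemma dcl_step N B a b c :
  is_structure model_language N ->
  dcl (Gamma 0 0 0 0) N B a -> dcl (Gamma 0 0 0 0) N B b ->
  in_rel N 0 [a; b; c] -> (forall d, in_rel N 0 [a; b; d] -> d = c) ->
  dcl (Gamma 0 0 0 0) N B c.
Proof.
intros HN [m Ha] [n Hb] Hc Hu. exists (S (max m n)). right.
exists (ternary_pformula 0 0 0 0), [a; b]. split; [reflexivity|].
split; [|split].
- repeat constructor; eapply cl_le; try eassumption; lia.
- exists [c]. split.
  + apply psat_F; [exact HN|]. eauto 8.
  + intros d Hd. apply psat_F in Hd as (x & y & z & E & -> & H); [|exact HN].
    injection E as <- <-. now rewrite (Hu z H).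
- exists [c]. split; [now left|]. apply psat_F; [exact HN|]. eauto 8.
Qed.

Lemma model_F_npair e e' e'' i j k :
  model_F (npair e i) (npair e' j) (npair e'' k) = true <->
  e = e' /\ e = e'' /\
  (i = j /\ k = S i \/ i <> j /\ (k = 0 \/ i <= k /\ halts_at e k = true)).
Proof.
unfold model_F. rewrite !pfst_npair, !psnd_npair.
rewrite !Bool.andb_true_iff, !Nat.eqb_eq.
destruct (Nat.eqb_spec i j) as [E|E].
- rewrite Nat.eqb_eq. tauto.
- rewrite Bool.orb_true_iff, Bool.andb_true_iff, Nat.eqb_eq, Nat.leb_le. tauto.
Qed.

(** Different values of [e] do not interact.  A nonempty part of [B] over [e]
    yields everything above its elements, and everything over [e] if finitely
    many events happen for [e], because the closure then contains
    [g (npair e 0)].  Conversely a step with [i <> i'] has the solution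
    [g (npair e 0)], so its uniqueness means that no positive event from [i] on
    happens. *)
Lemma dcl_relabelling N g B a :
  is_structure model_language N -> relabelling N g ->
  (forall x, B x -> dom N x) ->
  dcl (Gamma 0 0 0 0) N B a <->
  exists e k j, a = g (npair e k) /\ B (g (npair e j)) /\ (j <= k \/ quiet e).
Proof.
intros HN Hg HB.
assert (HF : forall x y z, in_rel N 0 [g x; g y; g z] <-> model_F x y z = true).
{ intros x y z. rewrite (relabelling_F N g Hg). split.
  - intros (x' & y' & z' & Ex & Ey & Ez & H).
    apply (relabelling_inj N g Hg) in Ex as ->, Ey as ->, Ez as ->. exact H.
  - intros H. exists x, y, z. auto. }
assert (Hrange : forall x y c, in_rel N 0 [g x; g y; c] -> exists z, c = g z).
{ intros x y c H. apply (relabelling_F N g Hg) in H as (? & ? & z & _ & _ & E & _).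
  eauto. }
split.
- intros [m Hm]. revert a Hm. induction m as [|m IH]; intros c Hc.
  + pose proof (HB c Hc) as Hd. apply (relabelling_dom N g Hg) in Hd as [z ->].
    cbn in Hc. rewrite <- (npair_proj z) in *.
    exists (pfst z), (psnd z), (psnd z). auto.
  + destruct Hc as [Hc|(f & s & -> & Hs & (d & Hd & Hu) & s' & Hin & Hc)];
      [auto|].
    assert (Heq : s' = d) by (symmetry; auto). subst d. clear Hd.
    apply psat_F in Hc as (x & y & z & -> & -> & Hc); [|exact HN].
    destruct Hin as [->|[]].
    rewrite !Forall_cons_iff in Hs. destruct Hs as (Hx & Hy & _).
    apply IH in Hx as (e & i & j & -> & Hj & Hi).
    apply IH in Hy as (e' & i' & j' & -> & _ & _).
    destruct (Hrange _ _ _ Hc) as [z ->]. rewrite <- (npair_proj z) in *.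
    generalize (pfst z) (psnd z) Hc Hu. clear z Hc Hu.
    intros e'' k Hc Hu. apply HF, model_F_npair in Hc as (<- & <- & Hc).
    exists e, k, j. split; [reflexivity|]. split; [exact Hj|].
    destruct Hc as [[<- ->]|[Hne _]].
    * destruct Hi as [Hi|Hi]; auto.
    * right.
      assert (Huniq : forall l, model_F (npair e i) (npair e i') (npair e l) = true ->
        l = k).
      { intros l Hl. apply HF in Hl.
        assert (E : [g (npair e k)] = [g (npair e l)]).
        { apply Hu, psat_F; [exact HN|]. eauto 8. }
        injection E as E. apply (relabelling_inj N g Hg), npair_inj in E. now symmetry. }
      (* [S i] instead of [i] ensures [l <> 0]. *)
      exists (S i). intros l Hl. destruct (halts_at e l) eqn:El; [|reflexivity].
      assert (H0 : 0 = k) by (apply Huniq, model_F_npair; auto 10).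
      assert (H1 : l = k).
      { apply Huniq, model_F_npair. repeat split. right. split; [exact Hne|].
        right. split; [lia|exact El]. }
      lia.
- intros (e & k & j & -> & Hj & Hk).
  assert (Hsucc : forall i, dcl (Gamma 0 0 0 0) N B (g (npair e i)) ->
    dcl (Gamma 0 0 0 0) N B (g (npair e (S i)))).
  { intros i Hi. apply (dcl_step N B _ _ _ HN Hi Hi).
    - apply HF, model_F_npair. auto.
    - intros d Hd. destruct (Hrange _ _ _ Hd) as [z ->].
      rewrite <- (npair_proj z) in *. apply HF, model_F_npair in Hd.
      destruct Hd as (_ & <- & [[_ ->]|[H _]]); [reflexivity|now destruct H]. }
  assert (Hup : forall i l, i <= l -> dcl (Gamma 0 0 0 0) N B (g (npair e i)) ->
    dcl (Gamma 0 0 0 0) N B (g (npair e l))).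
  { intros i l Hil Hi. induction Hil; auto. }
  assert (Hbase : dcl (Gamma 0 0 0 0) N B (g (npair e j))) by now exists 0.
  destruct Hk as [Hk|[i Hi]]; [now apply (Hup j)|].
  (* The first argument must lie above the last event and differ from the
     second one. *)
  apply (Hup 0); [lia|].
  apply (dcl_step N B (g (npair e (max i (S j)))) (g (npair e j))); auto.
  + apply (Hup j); [lia|exact Hbase].
  + apply HF, model_F_npair. repeat split. right. split; [lia|]. now left.
  + intros d Hd. destruct (Hrange _ _ _ Hd) as [z ->].
    rewrite <- (npair_proj z) in *. apply HF, model_F_npair in Hd.
    destruct Hd as (_ & <- & [[H _]|[_ [H|[Hle H]]]]).
    * lia.
    * now rewrite H.
    * rewrite Hi in H by lia. discriminate.
Qed.

(** * The reduction from Fin *)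
Lemma canonical_finset_pow2 b x : canonical_finset (2 ^ b) x <-> x = b.
Proof.
unfold canonical_finset. rewrite Nat.pow2_bits_eqb, Nat.eqb_eq. easy.
Qed.

Definition witness (g : nat -> nat) (e : nat) : nat :=
  npair (g (npair e 0)) (2 ^ g (npair e 1)).

Lemma witness_inj N g e e' :
  relabelling N g -> witness g e = witness g e' -> e = e'.
Proof.
intros Hg E. apply npair_inj in E as [E _].
apply (relabelling_inj N g Hg), npair_inj in E. apply E.
Qed.

Lemma Fin_witness N g e :
  is_structure model_language N -> relabelling N g ->
  Fin e <-> dcl_set (Gamma 0 0 0 0) N (witness g e).
Proof.
intros HN Hg. unfold dcl_set, witness. rewrite Fin_quiet.
set (B := canonical_finset (2 ^ g (npair e 1))).
assert (HB : forall x, B x -> dom N x).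
{ intros x Hx. apply canonical_finset_pow2 in Hx as ->.
  apply (relabelling_dom N g Hg). eauto. }
split.
- intros He. eexists _, _. split; [reflexivity|]. split; [exact HB|].
  apply (dcl_relabelling N g); auto. exists e, 0, 1.
  repeat split; auto. now apply canonical_finset_pow2.
- intros (a & u & E & _ & H). apply npair_inj in E as [<- <-].
  apply (dcl_relabelling N g) in H as (e' & k & j & Ea & Hj & H); auto.
  apply (relabelling_inj N g Hg), npair_inj in Ea as [<- <-].
  apply canonical_finset_pow2, (relabelling_inj N g Hg), npair_inj in Hj as [_ ->].
  destruct H as [H|H]; [lia|exact H].
Qed.

Lemma uniform_reduction :
  exists p : nat, forall N, is_structure model_language N ->
    isomorphic model_language N model ->
    one_reduction (atomic_diagram N) p Fin (dcl_set (Gamma 0 0 0 0) N).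
Proof.
destruct relabelling_program as [p Hp].
assert (H0 : computable (fun e => npair e 0)) by auto with computable.
assert (H1 : computable (fun e => npair e 1)) by auto with computable.
assert (H2 : computable (fun b => 2 ^ b)) by auto with computable.
destruct H0 as [p0 H0], H1 as [p1 H1], H2 as [p2 H2].
exists (program_index (PPair (PComp p p0) (PComp p2 (PComp p p1)))).
intros N HN Hiso. destruct (copy_relabelling N HN Hiso) as [g Hg].
exists (witness g). split; [|split].
- intros e. unfold phi. rewrite program_of_indexK. specialize (Hp N g Hg).
  constructor; [econstructor; eauto|].
  econstructor; [econstructor; eauto|apply H2].
- intros e e'. now apply (witness_inj N).
- intros e. now apply Fin_witness.
Qed.

(** * The closure is Sigma02 *)
Lemma Sigma02_intro (A : nat -> Prop) (b : nat -> nat -> nat -> bool) :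
  computable_pred (fun w => b (pfst w) (pfst (psnd w)) (psnd (psnd w))) ->
  (forall x, A x <-> exists n, forall m, b x n m = true) -> Sigma02 A.
Proof.
intros Cb HA.
exists (fun w => b (pfst w) (pfst (psnd w)) (psnd (psnd w)) = true). split.
- now apply (decides_computable_pred _ _ Cb).
- intros x. rewrite HA. split; intros [n Hn]; exists n; intros m;
    specialize (Hn m); now rewrite !psnd_npair, !pfst_npair in *.
Qed.

(** The existential quantifier guesses the numbers [e], [k], [j] of
    [dcl_relabelling] and a bound [i] on the events; the universal one checks
    the bound and that the finite set lies in the structure. *)
Lemma dcl_set_Sigma02 N :
  is_structure model_language N -> isomorphic model_language N model ->
  computable_structure model_language N -> Sigma02 (dcl_set (Gamma 0 0 0 0) N).
Proof.
intros HN Hiso HC. destruct (copy_relabelling N HN Hiso) as [g Hg].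
pose proof (computable_relabelling _ N g HC Hg) as Cg.
destruct HC as (_ & _ & d & _ & _ & _ & Hd & _).
apply computable_pred_decides in Hd as (bd & Cd & Hd).
apply (Sigma02_intro _ (fun w n m =>
  let e := pfst (pfst n) in let k := psnd (pfst n) in
  let j := pfst (psnd n) in let i := psnd (psnd n) in
  (negb (Nat.testbit (psnd w) m) || bd m) && (pfst w =? g (npair e k)) &&
  Nat.testbit (psnd w) (g (npair e j)) &&
  ((j <=? k) || (negb (i <=? m) || negb (halts_at e m))))%bool).
- cbv zeta.
  assert (forall f, computable f -> computable (fun x => g (f x))).
  { intros f Cf. now apply (computable_comp g). }
  assert (forall f, computable f -> computable_pred (fun x => bd (f x))).
  { intros f Cf. now apply (computable_pred_comp bd). }
  repeat apply computable_pred_and; auto 20 with computable.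
  repeat apply computable_pred_or; auto 20 with computable.
  apply computable_pred_not, computable_halts_at; auto 20 with computable.
- intros w. cbv zeta. split.
  + intros (a & u & -> & Hu & H).
    apply (dcl_relabelling N g) in H as (e & k & j & -> & Hj & H); auto.
    assert (Hi : exists i, forall m,
      ((j <=? k) || (negb (i <=? m) || negb (halts_at e m)))%bool = true).
    { destruct H as [H|[i Hi]].
      - exists 0. intros m. apply Nat.leb_le in H. now rewrite H.
      - exists i. intros m. destruct (Nat.leb_spec i m) as [Hle|Hlt].
        + rewrite Hi by exact Hle. now rewrite !Bool.orb_true_r.
        + now rewrite Bool.orb_true_r. }
    destruct Hi as [i Hi].
    exists (npair (npair e k) (npair j i)). intros m.
    repeat rewrite ?psnd_npair, ?pfst_npair.
    rewrite Hi, Nat.eqb_refl. unfold canonical_finset in Hj, Hu. rewrite Hj.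
    specialize (Hu m). rewrite <- Hd in Hu.
    destruct (Nat.testbit u m); cbn; [now rewrite Hu|reflexivity].
  + intros [n Hn].
    set (e := pfst (pfst n)) in *. set (k := psnd (pfst n)) in *.
    set (j := pfst (psnd n)) in *. set (i := psnd (psnd n)) in *.
    setoid_rewrite Bool.andb_true_iff in Hn.
    setoid_rewrite Bool.andb_true_iff in Hn.
    setoid_rewrite Bool.andb_true_iff in Hn.
    setoid_rewrite Nat.eqb_eq in Hn.
    exists (pfst w), (psnd w). split; [symmetry; apply npair_proj|].
    assert (Hu : forall x, canonical_finset (psnd w) x -> dom N x).
    { intros x Hx. destruct (Hn x) as (((Hx' & _) & _) & _).
      unfold canonical_finset in Hx. rewrite Hx in Hx'. now apply Hd. }
    split; [exact Hu|]. apply (dcl_relabelling N g); auto.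
    exists e, k, j. destruct (Hn 0) as (((_ & Ha) & Hj) & _).
    split; [exact Ha|]. split; [exact Hj|].
    destruct (Nat.leb_spec j k) as [Hle|Hlt]; [auto|]. right.
    exists i. intros m Hm. destruct (Hn m) as (_ & H).
    apply Nat.leb_le in Hm. rewrite Hm in H. cbn in H.
    now apply Bool.negb_true_iff.
Qed.

(** * Fin is Sigma02-hard *)
Fixpoint const_index (x : nat) : nat :=
  match x with
  | 0 => 0
  | S x => 6 + 4 * npair 1 (const_index x)
  end.

Lemma const_index_eq x : const_index x = program_index (const_program x).
Proof. induction x as [|x IH]; [reflexivity|]. cbn [const_index]. now rewrite IH. Qed.

Lemma const_program_inj x y : const_program x = const_program y -> x = y.
Proof.
revert y. induction x as [|x IH]; intros [|y] E; try discriminate; auto.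
injection E as E. auto.
Qed.

(** The s-m-n construction.  Its index depends on [x] through the index of a
    constant program only, and the latter is primitive recursive in [x]. *)
Definition fix_first (q : program) (x : nat) : program :=
  PComp q (PPair (const_program x) (PPair PFst PSnd)).

Lemma runs_fix_first O q x n y :
  runs O (fix_first q x) n y <-> runs O q (npair x n) y.
Proof.
assert (Hi : runs O (PPair (const_program x) (PPair PFst PSnd)) n (npair x n)).
{ constructor; [apply runs_const_program|].
  rewrite <- (npair_proj n). repeat constructor. }
split; intros H.
- inversion H as [| | | | | | |? ? ? z ? Hz Hq| | |]; subst.
  now rewrite (runs_functional _ _ _ _ _ Hi Hz).
- econstructor; eassumption.
Qed.

Lemma computable_fix_first q : computable (fun x => program_index (fix_first q x)).
Proof.
assert (Hc : computable const_index).
{ apply computable_ext with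
    (fun x => Nat.iter x (fun y => 6 + 4 * npair 1 y) 0).
  - intros x. induction x as [|x IH]; [reflexivity|].
    rewrite Nat.iter_succ, IH. reflexivity.
  - apply computable_iter; auto with computable.
    cbn [Nat.mul]. auto 20 with computable. }
apply computable_ext with (fun x =>
  6 + 4 * npair (program_index q)
    (5 + 4 * npair (const_index x) (program_index (PPair PFst PSnd)))).
- intros x. rewrite const_index_eq. reflexivity.
- cbn [Nat.mul]. auto 20 with computable.
Qed.

Lemma program_index_inj p q : program_index p = program_index q -> p = q.
Proof.
intros E. now rewrite <- (program_of_indexK p), E, program_of_indexK.
Qed.

(** If [B x] means that [R x n m] holds for some [n] and all [m], then let [q]
    on input [(x, k)] search, for each [n < k] in turn, an [m] refuting
    [R x n m].  It converges for an initial segment of numbers [k], which is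
    bounded iff some [n] cannot be refuted. *)
Lemma Sigma02_initial_segment B :
  Sigma02 B -> exists q, forall x,
    (B x <-> exists k, forall n, (exists y, runs no_oracle q (npair x n) y) -> n <= k).
Proof.
intros (R & [d Hd] & HB).
apply computable_pred_decides in Hd as (b & [r Hr] & Hb).
assert (Hs : computable (fun w =>
  npair (pfst (pfst w)) (npair (psnd (pfst w)) (psnd w))))
  by auto 10 with computable.
destruct Hs as [s Hs].
assert (Ht : computable (fun w => npair (pfst w) (pfst (psnd w))))
  by auto 10 with computable.
destruct Ht as [t Ht].
(* The value of [r] is [0] exactly where [R] fails. *)
set (refute := PMu (PComp r s)).
assert (Hrs : forall x n m, runs no_oracle (PComp r s) (npair (npair x n) m)
  (Nat.b2n (b (npair x (npair n m))))).
{ intros x n m. specialize (Hs no_oracle (npair (npair x n) m)).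
  rewrite !pfst_npair, !psnd_npair in Hs. econstructor; eauto. }
assert (Hrefute : forall x n, (exists m, runs no_oracle refute (npair x n) m) <->
  ~ forall m, R (npair x (npair n m))).
{ intros x n. split.
  - intros [m Hm] H. inversion Hm as [| | | | | | | | | |? ? ? H0 _]; subst.
    pose proof (runs_functional _ _ _ _ _ (Hrs x n m) H0) as E.
    rewrite (proj2 (Hb _) (H m)) in E. discriminate.
  - intros H. apply not_all_ex_not in H as [m Hm]. rewrite <- Hb in Hm.
    assert (Hleast : exists m, b (npair x (npair n m)) = false /\
      forall k, k < m -> b (npair x (npair n k)) = true).
    { clear -Hm. induction m as [m IH] using lt_wf_ind.
      destruct (classic (exists k, k < m /\ b (npair x (npair n k)) <> true))
        as [(k & Hk & H)|H]; [eauto|].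
      exists m. split; [now apply Bool.not_true_is_false|]. intros k Hk.
      destruct (b (npair x (npair n k))) eqn:E; [reflexivity|].
      exfalso. apply H. exists k. split; [exact Hk|congruence]. }
    clear m Hm. destruct Hleast as (m & Hm & Hlt). exists m. constructor.
    + specialize (Hrs x n m). now rewrite Hm in Hrs.
    + intros k Hk. exists 0. specialize (Hrs x n k).
      now rewrite (Hlt k Hk) in Hrs. }
set (q := PRec PZero (PComp refute t)).
assert (Hq : forall x k, (exists y, runs no_oracle q (npair x k) y) <->
  forall n, n < k -> ~ forall m, R (npair x (npair n m))).
{ intros x k. split.
  - induction k as [|k IH]; [lia|]. intros [y Hy] n Hn.
    apply runs_rec_inv in Hy as [(x' & E & _)|(x' & k' & y' & E & Hr' & Hq)];
      apply npair_inj in E as [<- E]; [discriminate|]. injection E as <-.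
    destruct (Nat.eq_dec n k) as [->|Hne].
    + apply Hrefute. exists y.
      inversion Hq as [| | | | | | |? ? ? z ? Hz Hm| | |]; subst.
      pose proof (runs_functional _ _ _ _ _ (Ht _ _) Hz) as E.
      rewrite !psnd_npair, !pfst_npair in E. now rewrite E.
    + apply IH; [now exists y'|lia].
  - induction k as [|k IH]; intros H.
    + exists 0. repeat constructor.
    + destruct IH as [y Hy]; [auto|].
      destruct (proj2 (Hrefute x k)) as [z Hz]; [auto|].
      exists z. econstructor; [exact Hy|].
      specialize (Ht no_oracle (npair x (npair k y))).
      rewrite !psnd_npair, !pfst_npair in Ht. econstructor; eauto. }
exists q. intros x. rewrite HB. split.
- intros [n Hn]. exists n. intros k Hk.
  destruct (le_lt_dec k n) as [Hle|Hlt]; [exact Hle|].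
  exfalso. exact (proj1 (Hq x k) Hk n Hlt Hn).
- intros [k Hk]. apply NNPP. intros H.
  (* If all [n] were refuted, then [q] would converge at [S k], too. *)
  assert (S k <= k) as Hle.
  { apply Hk, Hq. intros n _ Hn. apply H. now exists n. }
  lia.
Qed.

(** The reduction is injective because [x] can be read off the program
    [fix_first q x]. *)
Lemma Fin_hard B :
  Sigma02 B -> exists f, computable f /\ (forall x y, f x = f y -> x = y) /\
    forall x, B x <-> Fin (f x).
Proof.
intros HB. apply Sigma02_initial_segment in HB as [q Hq].
exists (fun x => program_index (fix_first q x)).
split; [apply computable_fix_first|]. split.
- intros x y E. apply program_index_inj in E. injection E as E.
  now apply const_program_inj.
- intros x. rewrite Hq. unfold Fin, W, phi. rewrite program_of_indexK.
  setoid_rewrite runs_fix_first. split.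
  + intros [k Hk]. exists (seq 0 (S k)). intros n Hn.
    apply in_seq. apply Hk in Hn. lia.
  + intros [s Hs]. exists (list_max s). intros n Hn. apply Hs in Hn.
    pose proof (proj1 (list_max_le s (list_max s)) (le_n _)) as H.
    rewrite Forall_forall in H. auto.
Qed.

Theorem proposition4p4 :
  exists (c : nat) (L : language) (M : structure) (F j0 j1 j2 : nat),
    CompStr_code c L M /\
    in_index (rel_index L) F /\
    rel_type L F = [j0; j1; j2] /\
    (exists p : nat,
       forall N : structure, is_structure L N -> isomorphic L N M ->
         one_reduction (atomic_diagram N) p Fin (dcl_set (Gamma F j0 j1 j2) N)) /\
    (forall N : structure, is_structure L N -> isomorphic L N M ->
       computable_structure L N ->
       Sigma02_complete (dcl_set (Gamma F j0 j1 j2) N)).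
Proof.
destruct model_CompStr as [c Hc].
exists c, model_language, model, 0, 0, 0, 0.
split; [exact Hc|]. split; [exact I|]. split; [reflexivity|].
split; [exact uniform_reduction|].
intros N HN Hiso HC. split; [now apply dcl_set_Sigma02|].
intros B HB. destruct (copy_relabelling N HN Hiso) as [g Hg].
pose proof (computable_relabelling _ N g HC Hg) as Cg.
destruct (Fin_hard B HB) as (f & Cf & Hf & HBf).
assert (Cw : computable (fun x => witness g (f x))).
{ assert (forall f, computable f -> computable (fun x => g (f x))).
  { intros h Ch. now apply (computable_comp g). }
  unfold witness. auto 10 with computable. }
destruct Cw as [p Hp]. exists (program_index p), (fun x => witness g (f x)).
split; [|split].
- intros x. unfold phi. rewrite program_of_indexK. apply Hp.
- intros x y E. apply Hf. now apply (witness_inj N g).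
- intros x. rewrite HBf. now apply Fin_witness.
Qed.
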